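(* Let $F:\mathbb{R}^n\to\mathbb{R}$ be a closed convex function, $A\in\mathbb{R}^{m\times n}$, $b\in\mathbb{R}^m$, suppose the KKT set $\Omega$ of the problem $\min_x F(x)$ s.t. $Ax=b$ is nonempty, and let $(x^*,\lambda^* )\in\Omega$. Let $\{(x_k,\lambda_k,\bar x_k,\bar\lambda_k)\}_{k\ge 1}$ be a sequence generated by Algorithm 1 (described in the context) with parameters $s>0$, $\alpha\ge 3$ and matrices satisfying $M_{k-1}\succcurlyeq M_k$ for all $k\ge 1$. Put $$\mathcal{E}_1=\tfrac12\|x_1-x^*\|_{M_0}^2+\tfrac12\|\lambda_1-\lambda^*\|^2 .$$ Then the following hold. (i) $\displaystyle\sum_{k=1}^{+\infty}k^2\left(\|x_{k+1}-\bar x_k\|_{M_k}^2+\|\lambda_{k+1}-\bar\lambda_k\|^2\right)<+\infty$. (ii) For all $k>1$, $$\|Ax_k-b\|\le \frac{4(\alpha-1)^2\sqrt{2\mathcal{E}_1}}{s(k-1)(k+\alpha-3)},$$ $$|F(x_k)-F(x^* )|\le \frac{(\alpha-1)^2\mathcal{E}_1}{s(k^2-k)}+\frac{4(\alpha-1)^2\sqrt{2\mathcal{E}_1}\,\|\lambda^*\|}{s(k-1)(k+\alpha-3)} .$$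
   Context: Notation: $\|\cdot\|$ is the Euclidean norm. $\mathbb{S}_+(n)$ is the set of (symmetric) positive semidefinite $n\times n$ real matrices; for $M\in\mathbb{S}_+(n)$, $\|x\|_M=\sqrt{x^TMx}$ (a semi-norm); $M_1\succcurlyeq M_2$ means $\|x\|_{M_1}\ge\|x\|_{M_2}$ for all $x\in\mathbb{R}^n$. $\partial F(x)=\{v\in\mathbb{R}^n: F(y)\ge F(x)+\langle v,y-x\rangle\ \forall y\in\mathbb{R}^n\}$ is the convex subdifferential. KKT set: $\Omega$ is the set of $(x^*,\lambda^* )\in\mathbb{R}^n\times\mathbb{R}^m$ with $-A^T\lambda^*\in\partial F(x^* )$ and $Ax^*-b=0$. Algorithm 1. Initialization: choose $x_0\in\mathbb{R}^n$, $\lambda_0\in\mathbb{R}^m$, set $x_1=x_0$, $\lambda_1=\lambda_0$, choose $M_0\in\mathbb{S}_+(n)$ and parameters $s>0$, $\alpha\ge3$. For $k=1,2,\dots$: Step 1: $\bar x_k=x_k+\frac{k-2}{k+\alpha-2}(x_k-x_{k-1})$, $\bar\lambda_k=\lambda_k+\frac{k-2}{k+\alpha-2}(\lambda_k-\lambda_{k-1})$. Step 2: set $\hat\lambda_k=\frac{k+\alpha-2}{\alpha-1}\bar\lambda_k-\frac{k-1}{\alpha-1}\lambda_k$ and $\eta_k=\frac{k-1}{k+\alpha-2}Ax_k+\frac{\alpha-1}{k+\alpha-2}b$; choose $M_k\in\mathbb{S}_+(n)$ and take $$x_{k+1}\in\arg\min_x\ F(x)+\frac{k+\alpha-2}{2sk}\|x-\bar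 x_k\|_{M_k}^2+\frac{sk(k+\alpha-2)}{2(\alpha-1)^2}\|Ax-\eta_k\|^2+\langle A^T\hat\lambda_k,x\rangle .$$ Step 3: $\lambda_{k+1}=\bar\lambda_k+\frac{sk}{k+\alpha-2}\left(Ax_{k+1}-b+\frac{k-1}{\alpha-1}A(x_{k+1}-x_k)\right)$. ''A sequence generated by Algorithm 1'' means any infinite sequence satisfying these relations for all $k\ge1$ (no stopping condition is applied). *)

(* Defs.v *)
From HB Require Import structures.
From mathcomp Require Import all_boot all_order all_algebra.
From mathcomp Require Import all_classical all_reals all_analysis.
Set Implicit Arguments.
Unset Strict Implicit.
Unset Printing Implicit Defensive.
Import Order.TTheory GRing.Theory Num.Theory.
Import numFieldNormedType.Exports.
Local Open Scope classical_set_scope.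
Local Open Scope ring_scope.

Definition dot (R : realType) (n : nat) (u v : 'cV[R]_n) : R :=
  (u^T *m v) 0 0.

(* The library norm [`|u|] on matrices is the sup norm, hence this one. *)
Definition enorm (R : realType) (n : nat) (u : 'cV[R]_n) : R :=
  Num.sqrt (dot u u).

Definition psd (R : realType) (n : nat) : set 'M[R]_n :=
  [set M | M^T = M /\ forall u : 'cV[R]_n, 0 <= dot u (M *m u)].

(* [Num.sqrt] vanishes on negative reals, so this is the intended semi-norm
   only for [M] in [psd]. *)
Definition mnorm (R : realType) (n : nat) (M : 'M[R]_n) (u : 'cV[R]_n) : R :=
  Num.sqrt (dot u (M *m u)).

Definition succeq (R : realType) (n : nat) (M1 M2 : 'M[R]_n) : Prop :=
  forall u : 'cV[R]_n, mnorm M1 u >= mnorm M2 u.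

(* Closed in the sense of convex analysis: the epigraph is a closed subset of
   R^n x R. *)
Definition closed_function (R : realType) (n : nat) (F : 'cV[R]_n -> R) : Prop :=
  closed [set p : 'cV[R]_n * R | F p.1 <= p.2].

Definition subdifferential (R : realType) (n : nat) (F : 'cV[R]_n -> R)
    (x : 'cV[R]_n) : set 'cV[R]_n :=
  [set v | forall y : 'cV[R]_n, F y >= F x + dot v (y - x)].

Definition argmin (R : realType) (T : Type) (f : T -> R) : set T :=
  [set x | forall y : T, f x <= f y].

Definition KKT_set (R : realType) (n m : nat) (F : 'cV[R]_n -> R)
    (A : 'M[R]_(m, n)) (b : 'cV[R]_m) : set ('cV[R]_n * 'cV[R]_m) :=
  [set p | subdifferential F p.1 (- (A^T *m p.2)) /\ A *m p.1 - b = 0].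

Definition lambda_hat (R : realType) (m : nat) (alpha : R)
    (lam lambar : nat -> 'cV[R]_m) (k : nat) : 'cV[R]_m :=
  ((k%:R + alpha - 2) / (alpha - 1)) *: lambar k
  - ((k%:R - 1) / (alpha - 1)) *: lam k.

Definition eta (R : realType) (n m : nat) (A : 'M[R]_(m, n)) (b : 'cV[R]_m)
    (alpha : R) (x : nat -> 'cV[R]_n) (k : nat) : 'cV[R]_m :=
  ((k%:R - 1) / (k%:R + alpha - 2)) *: (A *m x k)
  + ((alpha - 1) / (k%:R + alpha - 2)) *: b.

Definition primal_objective (R : realType) (n m : nat) (F : 'cV[R]_n -> R)
    (A : 'M[R]_(m, n)) (b : 'cV[R]_m) (s alpha : R) (M : nat -> 'M[R]_n)
    (x xbar : nat -> 'cV[R]_n) (lam lambar : nat -> 'cV[R]_m)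
    (k : nat) (z : 'cV[R]_n) : R :=
  F z
  + (k%:R + alpha - 2) / (2 * s * k%:R) * mnorm (M k) (z - xbar k) ^+ 2
  + s * k%:R * (k%:R + alpha - 2) / (2 * (alpha - 1) ^+ 2)
    * enorm (A *m z - eta A b alpha x k) ^+ 2
  + dot (A^T *m lambda_hat alpha lam lambar k) z.

(* [xbar 0] and [lambar 0] are unconstrained and carry no meaning: the
   extrapolated points are only defined from index 1 on. *)
Record algorithm1 (R : realType) (n m : nat) (F : 'cV[R]_n -> R)
    (A : 'M[R]_(m, n)) (b : 'cV[R]_m) (s alpha : R) (M : nat -> 'M[R]_n)
    (x xbar : nat -> 'cV[R]_n) (lam lambar : nat -> 'cV[R]_m) : Prop :=
  Algorithm1 {
    algorithm1_x_init : x 1%N = x 0%N ;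
    algorithm1_lam_init : lam 1%N = lam 0%N ;
    algorithm1_psd : forall k : nat, psd (M k) ;
    algorithm1_xbar : forall k : nat, (1 <= k)%N ->
      xbar k = x k
        + ((k%:R - 2) / (k%:R + alpha - 2)) *: (x k - x k.-1) ;
    algorithm1_lambar : forall k : nat, (1 <= k)%N ->
      lambar k = lam k
        + ((k%:R - 2) / (k%:R + alpha - 2)) *: (lam k - lam k.-1) ;
    algorithm1_x : forall k : nat, (1 <= k)%N ->
      argmin (primal_objective F A b s alpha M x xbar lam lambar k) (x k.+1) ;
    algorithm1_lam : forall k : nat, (1 <= k)%N ->
      lam k.+1 = lambar k
        + (s * k%:R / (k%:R + alpha - 2)) *:
          (A *m x k.+1 - b
           + ((k%:R - 1) / (alpha - 1)) *: (A *m (x k.+1 - x k)))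
  }.

(* Main.v *)
(* With z_k = x_k + (k-2)/(alpha-1) (x_k - x_{k-1}) and mu_k defined likewise
   from lambda, the algorithm is an implicit step
     -((alpha-1)/(s k) M_k (z_{k+1} - z_k) + A^T mu_{k+1}) in dF(x_{k+1}),
     mu_{k+1} - mu_k = s k/(alpha-1) (A z_{k+1} - b).
   Testing the subgradient at xstar and x_k shows that
     s k(k-1)/(alpha-1)^2 (L(x_k) - L(xstar))
       + 1/2 |z_k - xstar|^2_{M_{k-1}} + 1/2 |mu_k - lamstar|^2,
   where L = F + <lamstar, A . - b>, decreases by at least
   1/2 |z_{k+1} - z_k|^2_{M_k} + 1/2 |mu_{k+1} - mu_k|^2. Summing gives (i) and
   the bound on L. The feasibility rate comes from the boundedness of mu_k
   through the recursion satisfied by (k-1)(k+alpha-3)(A x_k - b). *)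
Require Import Defs.
From HB Require Import structures.
From mathcomp Require Import all_boot all_order all_algebra.
From mathcomp Require Import all_classical all_reals all_analysis.
From mathcomp Require Import ring lra.
Set Implicit Arguments.
Unset Strict Implicit.
Unset Printing Implicit Defensive.
Import Order.TTheory GRing.Theory Num.Theory.
Import numFieldNormedType.Exports.
Local Open Scope classical_set_scope.
Local Open Scope ring_scope.

(** * Inner product, Euclidean norm and matrix semi-norms *)

Lemma dotE (R : realType) (n : nat) (u v : 'cV[R]_n) :
  dot u v = \sum_(i < n) u i 0 * v i 0.
Proof. by rewrite /dot mxE; apply: eq_bigr => i _; rewrite !mxE. Qed.

Lemma dotC (R : realType) (n : nat) (u v : 'cV[R]_n) : dot u v = dot v u.
Proof. by rewrite !dotE; apply: eq_bigr => i _; rewrite mulrC. Qed.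

Lemma dotDr (R : realType) (n : nat) (u v w : 'cV[R]_n) :
  dot u (v + w) = dot u v + dot u w.
Proof. by rewrite /dot mulmxDr mxE. Qed.

Lemma dotZr (R : realType) (n : nat) (c : R) (u v : 'cV[R]_n) :
  dot u (c *: v) = c * dot u v.
Proof. by rewrite /dot -scalemxAr mxE. Qed.

Lemma dotNr (R : realType) (n : nat) (u v : 'cV[R]_n) : dot u (- v) = - dot u v.
Proof. by rewrite -scaleN1r dotZr mulN1r. Qed.

Lemma dotDl (R : realType) (n : nat) (u v w : 'cV[R]_n) :
  dot (u + v) w = dot u w + dot v w.
Proof. by rewrite dotC dotDr !(dotC w). Qed.

Lemma dotZl (R : realType) (n : nat) (c : R) (u v : 'cV[R]_n) :
  dot (c *: u) v = c * dot u v.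
Proof. by rewrite dotC dotZr dotC. Qed.

Lemma dotNl (R : realType) (n : nat) (u v : 'cV[R]_n) : dot (- u) v = - dot u v.
Proof. by rewrite dotC dotNr dotC. Qed.

Definition dot_linear := (dotDl, dotDr, dotZl, dotZr, dotNl, dotNr).

Lemma dot_tr (R : realType) (n m : nat) (A : 'M[R]_(m, n)) (u : 'cV[R]_m)
    (v : 'cV[R]_n) : dot (A^T *m u) v = dot u (A *m v).
Proof. by rewrite /dot trmx_mul trmxK mulmxA. Qed.

Lemma dot_ge0 (R : realType) (n : nat) (u : 'cV[R]_n) : 0 <= dot u u.
Proof. by rewrite dotE; apply: sumr_ge0 => i _; rewrite -expr2 sqr_ge0. Qed.

Lemma enorm_ge0 (R : realType) (n : nat) (u : 'cV[R]_n) : 0 <= enorm u.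
Proof. exact: sqrtr_ge0. Qed.

Lemma enorm_sqr (R : realType) (n : nat) (u : 'cV[R]_n) :
  enorm u ^+ 2 = dot u u.
Proof. by rewrite /enorm sqr_sqrtr ?dot_ge0. Qed.

Lemma mnorm_sqr (R : realType) (n : nat) (M : 'M[R]_n) (u : 'cV[R]_n) :
  psd M -> mnorm M u ^+ 2 = dot u (M *m u).
Proof. by move=> [_ M0]; rewrite /mnorm sqr_sqrtr. Qed.

Lemma psd_sym (R : realType) (n : nat) (M : 'M[R]_n) (u v : 'cV[R]_n) :
  psd M -> dot u (M *m v) = dot v (M *m u).
Proof. by move=> [MT _]; rewrite -dot_tr MT dotC. Qed.

(** Cauchy-Schwarz, from the nonnegativity of the squared length of |v|^2 u - (u.v) v. That square
    equals |v|^2 (|u|^2 |v|^2 - (u.v)^2), so the case v = 0 is treated apart. *)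
Lemma dot_le (R : realType) (n : nat) (u v : 'cV[R]_n) :
  dot u v <= enorm u * enorm v.
Proof.
have [v0|v0] := eqVneq (enorm v) 0.
  have dv0 : dot v v = 0 by rewrite -enorm_sqr v0 expr0n.
  have vE i : v i 0 = 0.
    move/eqP: dv0; rewrite dotE psumr_eq0 => [/allP/(_ i)|j _]; last first.
      by rewrite -expr2 sqr_ge0.
    by rewrite mem_index_enum -expr2 sqrf_eq0 => /(_ isT)/eqP.
  by rewrite v0 mulr0 dotE big1// => i _; rewrite vE mulr0.
have vgt0 : 0 < enorm v by rewrite lt0r v0 enorm_ge0.
have := dot_ge0 (dot v v *: u - dot u v *: v).
rewrite !dot_linear (dotC v u) -!enorm_sqr.
set a := enorm u; set c := enorm v; set d := dot u v => h.
have {}h : 0 <= c ^+ 2 * ((a * c) ^+ 2 - d ^+ 2).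
  by apply: le_trans h _; rewrite le_eqVlt; apply/orP; left; apply/eqP; ring.
rewrite pmulr_rge0 ?exprn_gt0// subr_ge0 in h.
apply: le_trans (ler_norm _) _.
by rewrite -(@ler_pXn2r _ 2)// ?nnegrE ?mulr_ge0 ?enorm_ge0// real_normK ?num_real.
Qed.

Lemma enormD (R : realType) (n : nat) (u v : 'cV[R]_n) :
  enorm (u + v) <= enorm u + enorm v.
Proof.
rewrite -(@ler_pXn2r _ 2)// ?nnegrE ?addr_ge0 ?enorm_ge0//.
rewrite sqrrD !enorm_sqr !dot_linear (dotC v u).
by have := dot_le u v; lra.
Qed.

Lemma enormZ (R : realType) (n : nat) (c : R) (u : 'cV[R]_n) :
  enorm (c *: u) = `|c| * enorm u.
Proof.
by rewrite /enorm !dot_linear mulrA -expr2 sqrtrM ?sqr_ge0// sqrtr_sqr.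
Qed.

Lemma enormN (R : realType) (n : nat) (u : 'cV[R]_n) : enorm (- u) = enorm u.
Proof. by rewrite -scaleN1r enormZ normrN normr1 mul1r. Qed.

Lemma norm_dot_le (R : realType) (n : nat) (u v : 'cV[R]_n) :
  `|dot u v| <= enorm u * enorm v.
Proof. by rewrite ler_norml dot_le lerNl -dotNl (le_trans (dot_le _ _))// enormN. Qed.

(** Polarization, with the symmetry of [M] merging the cross terms. It turns the step terms of the
    optimality condition into telescoping differences plus the square of the step. *)
Lemma psd_three_points (R : realType) (n : nat) (M : 'M[R]_n) (u v w : 'cV[R]_n) :
  psd M ->
  2 * dot (M *m (u - v)) (u - w)
    = mnorm M (u - w) ^+ 2 - mnorm M (v - w) ^+ 2 + mnorm M (u - v) ^+ 2.
Proof.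
move=> pM; rewrite !mnorm_sqr// dotC !mulmxBr !dot_linear.
by rewrite (psd_sym v u)// (psd_sym w u)// (psd_sym w v)//; ring.
Qed.

Lemma three_points (R : realType) (n : nat) (u v w : 'cV[R]_n) :
  2 * dot (u - v) (u - w)
    = enorm (u - w) ^+ 2 - enorm (v - w) ^+ 2 + enorm (u - v) ^+ 2.
Proof.
by rewrite !enorm_sqr !dot_linear (dotC v u) (dotC w u) (dotC w v); ring.
Qed.

(** * First-order optimality for a convex function plus a quadratic *)

(* The quadratic term along the segment is killed by letting the step tend
   to 0, so no differentiability of F is involved. *)
Lemma argmin_first_order (R : realType) (n : nat) (F phi : 'cV[R]_n -> R)
    (u d : 'cV[R]_n) (G Q : R) :
  convex_function [set: 'cV[R]_n] F ->
  argmin (fun z => F z + phi z) u ->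
  (forall t : R, phi (u + t *: d) = phi u + t * G + t ^+ 2 * Q) ->
  F u - G <= F (u + d).
Proof.
move=> cF umin phiE.
have key t : 0 < t -> t <= 1 -> F u - G <= F (u + d) + t * Q.
  move=> t0 t1.
  pose t' : {i01 R} := Itv01 (ltW t0) t1.
  have := cF t' (u + d) u (in_setT _) (in_setT _).
  rewrite convRE /conv /= => cFt.
  have E : t *: (u + d) + (1 - t) *: u = u + t *: d.
    by rewrite scalerDr scalerBl scale1r addrC addrA subrK.
  rewrite E in cFt.
  have := umin (u + t *: d); rewrite /= phiE => le_u.
  rewrite /unstable.onem in cFt; rewrite -(ler_pM2l t0); lra.
apply/ler_addgt0Pr => e e0.
have [Q0|Q0] := leP Q 0.
  by have := key 1 ltr01 (lexx _); lra.
pose t := Num.min 1 (e / Q).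
have t0 : 0 < t by rewrite lt_min ltr01 divr_gt0.
have t1 : t <= 1 by rewrite ge_min lexx.
have te : t * Q <= e.
  by rewrite -ler_pdivlMr// /t ge_min lexx orbT.
by have := key t t0 t1; lra.
Qed.

(** * The implicit scheme satisfied by the extrapolated sequences *)

(* [extrap alpha x] and [extrap alpha lam] are the primal and dual sequences
   in which the energy is a sum of squares. *)
Definition extrap (R : realType) (n : nat) (alpha : R) (x : nat -> 'cV[R]_n)
    (k : nat) : 'cV[R]_n :=
  x k + ((k%:R - 2) / (alpha - 1)) *: (x k - x k.-1).

(** The coefficient of x_{k+1} - x_k in the increment is 1 + (k-1)/(alpha-1) =
    (k+alpha-2)/(alpha-1); factoring it out leaves exactly the extrapolation weight of Step 1. It
    serves the primal and the dual sequence alike. *)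
Lemma extrap_diff (R : realType) (n : nat) (alpha : R) (x : nat -> 'cV[R]_n)
    (xbark : 'cV[R]_n) (k : nat) :
  3 <= alpha -> (1 <= k)%N ->
  xbark = x k + ((k%:R - 2) / (k%:R + alpha - 2)) *: (x k - x k.-1) ->
  extrap alpha x k.+1 - extrap alpha x k
    = ((k%:R + alpha - 2) / (alpha - 1)) *: (x k.+1 - xbark).
Proof.
move=> a3 k1 ->; have k1' : 1 <= k%:R :> R by rewrite ler1n.
apply/matrixP => i j; rewrite /extrap /= !mxE -natr1.
by field; apply/andP; split; apply/lt0r_neq0; lra.
Qed.

(** Identifies the bracket of the dual update as the constraint residual at z_{k+1}, so that the
    dual step is implicit. *)
Lemma extrap_constraint (R : realType) (n m : nat) (A : 'M[R]_(m, n))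
    (b : 'cV[R]_m) (alpha : R) (x : nat -> 'cV[R]_n) (k : nat) :
  3 <= alpha -> (1 <= k)%N ->
  A *m extrap alpha x k.+1 - b
    = A *m x k.+1 - b + ((k%:R - 1) / (alpha - 1)) *: (A *m (x k.+1 - x k)).
Proof.
move=> a3 k1; rewrite /extrap /= !mulmxDr -scalemxAr !mulmxDr !mulmxN.
apply/matrixP => i j; rewrite !mxE -natr1.
by field; apply/lt0r_neq0; lra.
Qed.

Lemma dual_extrap_diff (R : realType) (n m : nat) (F : 'cV[R]_n -> R)
    (A : 'M[R]_(m, n)) (b : 'cV[R]_m) (s alpha : R) (M : nat -> 'M[R]_n)
    (x xbar : nat -> 'cV[R]_n) (lam lambar : nat -> 'cV[R]_m) (k : nat) :
  3 <= alpha -> algorithm1 F A b s alpha M x xbar lam lambar -> (1 <= k)%N ->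
  extrap alpha lam k.+1 - extrap alpha lam k
    = (s * k%:R / (alpha - 1)) *: (A *m extrap alpha x k.+1 - b).
Proof.
move=> a3 alg k1; have k1' : 1 <= k%:R :> R by rewrite ler1n.
rewrite (extrap_diff a3 k1 (algorithm1_lambar alg k1)) (algorithm1_lam alg k1).
rewrite -extrap_constraint// [lambar k + _]addrC addrK scalerA; congr (_ *: _).
by field; apply/andP; split; apply/lt0r_neq0; lra.
Qed.

(** Explains the choice of [lambda_hat] and [eta]: A^T times the right-hand side is the gradient at
    x_{k+1} of the penalty and linear terms of the subproblem. *)
Lemma extrap_multiplier (R : realType) (n m : nat) (F : 'cV[R]_n -> R)
    (A : 'M[R]_(m, n)) (b : 'cV[R]_m) (s alpha : R) (M : nat -> 'M[R]_n)
    (x xbar : nat -> 'cV[R]_n) (lam lambar : nat -> 'cV[R]_m) (k : nat) :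
  3 <= alpha -> algorithm1 F A b s alpha M x xbar lam lambar -> (1 <= k)%N ->
  extrap alpha lam k.+1
    = (s * k%:R * (k%:R + alpha - 2) / (alpha - 1) ^+ 2)
        *: (A *m x k.+1 - Defs.eta A b alpha x k) + lambda_hat alpha lam lambar k.
Proof.
move=> a3 alg k1; have k1' : 1 <= k%:R :> R by rewrite ler1n.
rewrite /extrap /= (algorithm1_lam alg k1) /Defs.eta /lambda_hat mulmxDr mulmxN.
apply/matrixP => i j; rewrite !mxE -natr1.
by field; apply/andP; split; apply/lt0r_neq0; lra.
Qed.

Lemma primal_optimality (R : realType) (n m : nat) (F : 'cV[R]_n -> R)
    (A : 'M[R]_(m, n)) (b : 'cV[R]_m) (s alpha : R) (M : nat -> 'M[R]_n)
    (x xbar : nat -> 'cV[R]_n) (lam lambar : nat -> 'cV[R]_m) (k : nat) :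
  convex_function [set: 'cV[R]_n] F -> 0 < s -> 3 <= alpha ->
  algorithm1 F A b s alpha M x xbar lam lambar -> (1 <= k)%N ->
  subdifferential F (x k.+1)
    (- (((alpha - 1) / (s * k%:R))
          *: (M k *m (extrap alpha x k.+1 - extrap alpha x k))
        + A^T *m extrap alpha lam k.+1)).
Proof.
move=> cF s0 a3 alg k1 y; have k1' : 1 <= k%:R :> R by rewrite ler1n.
have pM := algorithm1_psd alg k.
have umin := algorithm1_x alg k1.
rewrite (extrap_diff a3 k1 (algorithm1_xbar alg k1)).
rewrite (extrap_multiplier a3 alg k1).
set u := x k.+1 in umin *; have [d dE] : {d | d = y - u} by eexists.
rewrite -dE.
have [p pE] : {p | p = u - xbar k} by eexists.
have [q qE] : {q | q = A *m u - Defs.eta A b alpha x k} by eexists.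
rewrite -pE -qE.
set lh := lambda_hat _ _ _ _.
pose c1 := (k%:R + alpha - 2) / (2 * s * k%:R).
pose c2 := s * k%:R * (k%:R + alpha - 2) / (2 * (alpha - 1) ^+ 2).
pose phi z := c1 * mnorm (M k) (z - xbar k) ^+ 2
  + c2 * enorm (A *m z - Defs.eta A b alpha x k) ^+ 2 + dot (A^T *m lh) z.
(* [phi] is quadratic, so its expansion along [d] is exact: the first coefficient is the derivative
   at [u], the second the curvature. *)
have := @argmin_first_order _ _ F phi u d
  (2 * c1 * dot p (M k *m d) + 2 * c2 * dot q (A *m d) + dot (A^T *m lh) d)
  (c1 * dot d (M k *m d) + c2 * dot (A *m d) (A *m d)) cF.
rewrite (_ : u + d = y) => [h|]; last by rewrite dE addrC subrK.
rewrite dotNl dotDl dotZl -scalemxAr dotZl (dotC (M k *m p)) (psd_sym _ _ pM).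
rewrite dot_tr dotDl dotZl -(dot_tr _ lh).
apply: le_trans _ (h _ _).
- rewrite le_eqVlt; apply/orP; left; apply/eqP; rewrite /c1 /c2.
  by field; rewrite !lt0r_neq0//; lra.
- by move=> z; have := umin z; rewrite /primal_objective /phi /c1 /c2 /lh !addrA.
- move=> t; rewrite /phi.
  have -> : u + t *: d - xbar k = p + t *: d by rewrite addrAC pE.
  have -> : A *m (u + t *: d) - Defs.eta A b alpha x k = q + t *: (A *m d).
    by rewrite mulmxDr -scalemxAr addrAC qE.
  rewrite !mnorm_sqr// !enorm_sqr -pE -qE mulmxDr -scalemxAr !dot_linear.
  by rewrite (psd_sym d p pM) (dotC (A *m d) q); ring.
Qed.

(** * Lagrangian gap and decrease of the energy *)

Definition lagrangian_gap (R : realType) (n m : nat) (F : 'cV[R]_n -> R)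
    (A : 'M[R]_(m, n)) (b : 'cV[R]_m) (xstar : 'cV[R]_n) (lamstar : 'cV[R]_m)
    (y : 'cV[R]_n) : R :=
  F y - F xstar + dot lamstar (A *m y - b).

Lemma lagrangian_gap_ge0 (R : realType) (n m : nat) (F : 'cV[R]_n -> R)
    (A : 'M[R]_(m, n)) (b : 'cV[R]_m) (xstar : 'cV[R]_n) (lamstar : 'cV[R]_m)
    (y : 'cV[R]_n) :
  KKT_set F A b (xstar, lamstar) ->
  0 <= lagrangian_gap F A b xstar lamstar y.
Proof.
move=> [/= /(_ y) Fy /eqP]; rewrite subr_eq0 => /eqP Axb.
move: Fy; rewrite dotNl dot_tr mulmxDr mulmxN Axb /lagrangian_gap; lra.
Qed.

(** The metric lags one index behind, so that the new energy is measured in M_k, the metric of the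
    step just made. At k = 1 the weight of the gap vanishes and the metric is M_0. *)
Definition energy (R : realType) (n m : nat) (F : 'cV[R]_n -> R)
    (A : 'M[R]_(m, n)) (b : 'cV[R]_m) (s alpha : R) (M : nat -> 'M[R]_n)
    (x : nat -> 'cV[R]_n) (lam : nat -> 'cV[R]_m)
    (xstar : 'cV[R]_n) (lamstar : 'cV[R]_m) (k : nat) : R :=
  s * k%:R * (k%:R - 1) / (alpha - 1) ^+ 2
    * lagrangian_gap F A b xstar lamstar (x k)
  + 2^-1 * mnorm (M k.-1) (extrap alpha x k - xstar) ^+ 2
  + 2^-1 * enorm (extrap alpha lam k - lamstar) ^+ 2.

(** Since z_{k+1} - xstar = (x_{k+1} - xstar) + r (x_{k+1} - x_k), the subgradient inequality at
    [xstar] with weight [c] plus the one at x_k with weight [c * r] produces exactly the inner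
    products of the two three-point identities. *)
Lemma energy_decrease (R : realType) (n m : nat) (F : 'cV[R]_n -> R)
    (A : 'M[R]_(m, n)) (b : 'cV[R]_m) (s alpha : R) (M : nat -> 'M[R]_n)
    (x xbar : nat -> 'cV[R]_n) (lam lambar : nat -> 'cV[R]_m)
    (xstar : 'cV[R]_n) (lamstar : 'cV[R]_m) (k : nat) :
  convex_function [set: 'cV[R]_n] F -> KKT_set F A b (xstar, lamstar) ->
  0 < s -> 3 <= alpha ->
  algorithm1 F A b s alpha M x xbar lam lambar ->
  (1 <= k)%N -> succeq (M k.-1) (M k) ->
  energy F A b s alpha M x lam xstar lamstar k.+1
    + 2^-1 * (mnorm (M k) (extrap alpha x k.+1 - extrap alpha x k) ^+ 2
              + enorm (extrap alpha lam k.+1 - extrap alpha lam k) ^+ 2)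
    <= energy F A b s alpha M x lam xstar lamstar k.
Proof.
move=> cF kkt s0 a3 alg k1 Mk; have k1' : 1 <= k%:R :> R by rewrite ler1n.
pose c := s * k%:R / (alpha - 1); pose e := (alpha - 1) / (s * k%:R).
pose r := (k%:R - 1) / (alpha - 1).
have a0 : 0 < alpha - 1 by lra.
have ce : c * e = 1 by rewrite /c /e; field; rewrite !lt0r_neq0//; lra.
have c0 : 0 <= c by rewrite divr_ge0 ?mulr_ge0 ?ltW//; lra.
have r0 : 0 <= r by rewrite divr_ge0 ?(ltW a0) ?subr_ge0.
have coefD : s * k%:R * (k%:R - 1) / (alpha - 1) ^+ 2 = c * r.
  by rewrite /c /r; field; exact: lt0r_neq0.
(* Here alpha >= 3 enters: up to s/(alpha-1)^2, the claim is k(k+1) <= k(k+alpha-2). It lets the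
   nonnegative gap at x_{k+1} carry the weight of the next energy. *)
have coefD' :
    s * (k%:R + 1) * (k%:R + 1 - 1) / (alpha - 1) ^+ 2 <= c * (1 + r).
  rewrite -subr_ge0 (_ : _ - _ = s * k%:R * (alpha - 3) / (alpha - 1) ^+ 2).
    by rewrite divr_ge0 ?sqr_ge0// !mulr_ge0 ?subr_ge0 ?(ltW s0).
  by rewrite /c /r; field; exact: lt0r_neq0.
have pM := algorithm1_psd alg k.
have sub := primal_optimality cF s0 a3 alg k1.
have dmuE := dual_extrap_diff a3 alg k1; rewrite -/c in dmuE.
have [_ /= /eqP] := kkt; rewrite subr_eq0 => /eqP Axb.
have Dp := lagrangian_gap_ge0 (x k.+1) kkt.
have zpE : extrap alpha x k.+1 =
    x k.+1 + r *: (x k.+1 - x k).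
  rewrite /r /extrap /= -natr1; congr (_ + (_ / _) *: _); ring.
have MM : mnorm (M k) (extrap alpha x k - xstar) ^+ 2
    <= mnorm (M k.-1) (extrap alpha x k - xstar) ^+ 2.
  by rewrite ler_pXn2r// ?nnegrE ?sqrtr_ge0.
have tz := psd_three_points (extrap alpha x k.+1) (extrap alpha x k) xstar pM.
have tmu := three_points (extrap alpha lam k.+1) (extrap alpha lam k) lamstar.
have sub1 := sub xstar; have sub2 := sub (x k); clear sub.
rewrite /energy /= -natr1.
set D' := lagrangian_gap _ _ _ _ _ (x k.+1) in Dp *.
set D := lagrangian_gap _ _ _ _ _ (x k).
set P := M k *m _ in tz sub1 sub2.
rewrite -/e in sub1 sub2.
rewrite !dotNl !dotDl !dotZl !dot_tr in sub1 sub2.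
have tzE : dot P (extrap alpha x k.+1 - xstar)
    = - dot P (xstar - x k.+1) - r * dot P (x k - x k.+1).
  by rewrite {1}zpE !dot_linear; ring.
have AzE : A *m extrap alpha x k.+1 - b
    = - (A *m (xstar - x k.+1)) - r *: (A *m (x k - x k.+1)).
  rewrite zpE !mulmxDr -scalemxAr !mulmxDr !mulmxN Axb.
  by apply/matrixP => i j; rewrite !mxE; ring.
have lE : dot lamstar (A *m extrap alpha x k.+1 - b)
    = (1 + r) * dot lamstar (A *m x k.+1 - b) - r * dot lamstar (A *m x k - b).
  rewrite zpE mulmxDr -scalemxAr mulmxDr mulmxN !dot_linear; ring.
have muE : dot (extrap alpha lam k.+1) (A *m extrap alpha x k.+1 - b)
    = - dot (extrap alpha lam k.+1) (A *m (xstar - x k.+1))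
      - r * dot (extrap alpha lam k.+1) (A *m (x k - x k.+1)).
  by rewrite AzE !dot_linear; ring.
have tmuE : dot (extrap alpha lam k.+1 - extrap alpha lam k)
      (extrap alpha lam k.+1 - lamstar)
    = c * (dot (extrap alpha lam k.+1) (A *m extrap alpha x k.+1 - b)
           - dot lamstar (A *m extrap alpha x k.+1 - b)).
  by rewrite dmuE dotZl dotC dotDl dotNl.
rewrite muE lE in tmuE.
rewrite tzE in tz; rewrite tmuE in tmu.
(* As [c * e = 1], these weights leave the M_k terms with coefficients 1 and [r], matching [tzE]. *)
have h1 := ler_wpM2l c0 sub1.
have h2 := ler_wpM2l (mulr_ge0 c0 r0) sub2.
have cancel_ce (u : R) : c * (e * u) = u by rewrite mulrA ce mul1r.
have cancel_cre (u : R) : c * r * (e * u) = r * u.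
  by rewrite mulrACA ce mul1r.
rewrite !(mulrDr c) !(mulrDr (c * r)) !mulrN !(mulrDr c) !(mulrDr (c * r)) in h1 h2.
rewrite !cancel_ce !cancel_cre in h1 h2.
have h3 := ler_wpM2r Dp coefD'.
rewrite coefD; move: h1 h2 h3 tz tmu MM.
rewrite /D' /D /lagrangian_gap; clear; lra.
Qed.

Lemma energy_sum (R : realType) (n m : nat) (F : 'cV[R]_n -> R)
    (A : 'M[R]_(m, n)) (b : 'cV[R]_m) (s alpha : R) (M : nat -> 'M[R]_n)
    (x xbar : nat -> 'cV[R]_n) (lam lambar : nat -> 'cV[R]_m)
    (xstar : 'cV[R]_n) (lamstar : 'cV[R]_m) (k : nat) :
  convex_function [set: 'cV[R]_n] F -> KKT_set F A b (xstar, lamstar) ->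
  0 < s -> 3 <= alpha ->
  algorithm1 F A b s alpha M x xbar lam lambar ->
  (forall k : nat, (1 <= k)%N -> succeq (M k.-1) (M k)) -> (1 <= k)%N ->
  energy F A b s alpha M x lam xstar lamstar k
    + 2^-1 * \sum_(1 <= j < k)
        (mnorm (M j) (extrap alpha x j.+1 - extrap alpha x j) ^+ 2
         + enorm (extrap alpha lam j.+1 - extrap alpha lam j) ^+ 2)
    <= 2^-1 * mnorm (M 0%N) (x 1%N - xstar) ^+ 2
       + 2^-1 * enorm (lam 1%N - lamstar) ^+ 2.
Proof.
move=> cF kkt s0 a3 alg Mn; elim: k => // -[_ _|k IH _].
  (* Since x_1 = x_0 and lam_1 = lam_0, the extrapolated points at index 1 are x_1 and lam_1
     themselves. *)
  rewrite big_geq// mulr0 addr0 /energy /extrap /= (algorithm1_x_init alg).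
  by rewrite (algorithm1_lam_init alg) !subrr !scaler0 !addr0 mulr0 mul0r mul0r add0r.
rewrite big_nat_recr//=; apply: le_trans (IH isT).
have := energy_decrease cF kkt s0 a3 alg (isT : (1 <= k.+1)%N) (Mn k.+1 isT).
by rewrite /=; clear; lra.
Qed.

(** * Feasibility rate from bounded dual errors *)

(** With r_j = A x_j - b, the dual update scaled by (alpha-1)^2/s reads p_{j+1} - p_j = j(j+alpha-2)
    r_{j+1} - j(j-1) r_j, whose first term is h_{j+1}. The factor 2 comes from h = (h - p) + p, both
    parts having the same bound. *)
Lemma residual_bound (R : realType) (n m : nat) (F : 'cV[R]_n -> R)
    (A : 'M[R]_(m, n)) (b : 'cV[R]_m) (s alpha : R) (M : nat -> 'M[R]_n)
    (x xbar : nat -> 'cV[R]_n) (lam lambar : nat -> 'cV[R]_m)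
    (lamstar : 'cV[R]_m) (C : R) (k : nat) :
  0 < s -> 3 <= alpha ->
  algorithm1 F A b s alpha M x xbar lam lambar ->
  (forall j : nat, (1 <= j)%N -> enorm (extrap alpha lam j - lamstar) <= C) ->
  (1 <= k)%N ->
  (k%:R - 1) * (k%:R + alpha - 3) * enorm (A *m x k - b)
    <= 2 * ((alpha - 1) ^+ 2 / s * C).
Proof.
move=> s0 a3 alg muC k1.
pose B := (alpha - 1) ^+ 2 / s.
have B0 : 0 <= B by rewrite divr_ge0 ?sqr_ge0 ?ltW.
pose p j := B *: (extrap alpha lam j - lamstar).
pose h j := ((j%:R - 1) * (j%:R + alpha - 3)) *: (A *m x j - b).
have pB j : (1 <= j)%N -> enorm (p j) <= B * C.
  by move=> j1; rewrite /p enormZ ger0_norm// ler_wpM2l// muC.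
(* The weighted residual minus the dual error is, at each step, a convex
   combination of its previous value and of the previous dual error. *)
have key j : (1 <= j)%N -> enorm (h j - p j) <= B * C.
  elim: j => // -[_ _|j IH _].
    by rewrite /h subrr mul0r scale0r add0r enormN pB.
  have j1 : (1 <= j.+1)%N by [].
  have j1' : 1 <= j.+1%:R :> R by rewrite ler1n.
  have := dual_extrap_diff a3 alg j1; rewrite extrap_constraint// => dmu.
  have muE : extrap alpha lam j.+2 = extrap alpha lam j.+1 +
    (s * j.+1%:R / (alpha - 1)) *:
      (A *m x j.+2 - b +
       ((j.+1%:R - 1) / (alpha - 1)) *: (A *m (x j.+2 - x j.+1))).
    by rewrite -dmu addrC subrK.
  (* This ratio turns the weight of h_j into the j(j-1) of the dual update, and alpha >= 3 makes it
     at most 1. *)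
  pose c := j.+1%:R / (j.+1%:R + alpha - 3).
  have t0 : 0 < j.+1%:R + alpha - 3 by lra.
  have c0 : 0 <= c by rewrite divr_ge0//; lra.
  have c1 : 0 <= 1 - c by rewrite subr_ge0 /c ler_pdivrMr//; lra.
  have -> : h j.+2 - p j.+2 = c *: (h j.+1 - p j.+1) - (1 - c) *: p j.+1.
    rewrite /h /p muE mulmxDr mulmxN /c /B; apply/matrixP => i l.
    rewrite !mxE -(natr1 j.+1); field.
    by rewrite !lt0r_neq0//; lra.
  apply: le_trans (enormD _ _) _; rewrite enormN (enormZ c) (enormZ (1 - c)) !ger0_norm//.
  have h1 := ler_wpM2l c0 (IH isT); have h2 := ler_wpM2l c1 (pB _ j1).
  by lra.
have k1' : 1 <= k%:R :> R by rewrite ler1n.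
rewrite -[X in X * enorm _]ger0_norm ?mulr_ge0//; try lra.
rewrite -enormZ -/(h k) -(subrK (p k) (h k)).
apply: le_trans (enormD _ _) _.
by have := key _ k1; have := pB _ k1; rewrite /B; lra.
Qed.

(** * Summability and convergence rates *)

Theorem theorem1 (R : realType) (n m : nat) (F : 'cV[R]_n -> R)
    (A : 'M[R]_(m, n)) (b : 'cV[R]_m) (s alpha : R) (M : nat -> 'M[R]_n)
    (x xbar : nat -> 'cV[R]_n) (lam lambar : nat -> 'cV[R]_m)
    (xstar : 'cV[R]_n) (lamstar : 'cV[R]_m)
    (F_closed : closed_function F)
    (F_convex : convex_function [set: 'cV[R]_n] F)
    (Omega_nonempty : KKT_set F A b !=set0)
    (star_in_Omega : KKT_set F A b (xstar, lamstar))
    (s_gt0 : 0 < s)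
    (alpha_ge3 : 3 <= alpha)
    (generated : algorithm1 F A b s alpha M x xbar lam lambar)
    (M_noninc : forall k : nat, (1 <= k)%N -> succeq (M k.-1) (M k)) :
  let E1 := 2^-1 * mnorm (M 0%N) (x 1%N - xstar) ^+ 2
            + 2^-1 * enorm (lam 1%N - lamstar) ^+ 2 in
  (\sum_(1 <= k <oo)
      (k%:R ^+ 2 * (mnorm (M k) (x k.+1 - xbar k) ^+ 2
                    + enorm (lam k.+1 - lambar k) ^+ 2))%:E < +oo)%E
  /\
  (forall k : nat, (1 < k)%N ->
      enorm (A *m x k - b)
        <= 4 * (alpha - 1) ^+ 2 * Num.sqrt (2 * E1)
           / (s * (k%:R - 1) * (k%:R + alpha - 3))
      /\
      `|F (x k) - F xstar|
        <= (alpha - 1) ^+ 2 * E1 / (s * (k%:R ^+ 2 - k%:R))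
           + 4 * (alpha - 1) ^+ 2 * Num.sqrt (2 * E1) * enorm lamstar
             / (s * (k%:R - 1) * (k%:R + alpha - 3))).
Proof.
move=> E1.
have E10 : 0 <= E1 by rewrite addr_ge0// mulr_ge0// ?sqr_ge0.
have a0 : 0 < alpha - 1 by lra.
pose S k := \sum_(1 <= j < k)
  (mnorm (M j) (extrap alpha x j.+1 - extrap alpha x j) ^+ 2
   + enorm (extrap alpha lam j.+1 - extrap alpha lam j) ^+ 2).
have S0 k : 0 <= S k by apply: sumr_ge0 => j _; rewrite addr_ge0 ?sqr_ge0.
have gap0 k : 0 <= lagrangian_gap F A b xstar lamstar (x k).
  exact: lagrangian_gap_ge0.
have weight0 k : (1 <= k)%N ->
    0 <= s * k%:R * (k%:R - 1) / (alpha - 1) ^+ 2 :> R.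
  move=> k1; rewrite divr_ge0 ?sqr_ge0// !mulr_ge0 ?(ltW s_gt0)//.
  by rewrite subr_ge0 ler1n.
have total k : (1 <= k)%N -> energy F A b s alpha M x lam xstar lamstar k
    + 2^-1 * S k <= E1.
  exact: (energy_sum F_convex star_in_Omega s_gt0 alpha_ge3 generated).
split.
  have term0 k : (0 <= (k%:R ^+ 2 * (mnorm (M k) (x k.+1 - xbar k) ^+ 2
      + enorm (lam k.+1 - lambar k) ^+ 2))%:E)%E.
    by rewrite lee_fin mulr_ge0 ?addr_ge0 ?sqr_ge0.
  apply: (@le_lt_trans _ _ (2 * (alpha - 1) ^+ 2 * E1)%:E); last exact: ltry.
  apply: lime_le; first by apply: is_cvg_nneseries => k _ _.
  near=> N; have N1 : (1 <= N)%N by near: N; exact: nbhs_infty_ge.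
  rewrite sumEFin lee_fin.
  (* Dropping the nonnegative energy in [total] gives S N <= 2 E1, uniformly in [N]. *)
  apply: (@le_trans _ _ ((alpha - 1) ^+ 2 * S N)); last first.
    have := total _ N1; have := mulr_ge0 (weight0 _ N1) (gap0 N).
    have := sqr_ge0 (mnorm (M N.-1) (extrap alpha x N - xstar)).
    have := sqr_ge0 (enorm (extrap alpha lam N - lamstar)).
    rewrite /energy => h1 h2 h3 h4.
    rewrite -mulrA mulrCA ler_wpM2l ?sqr_ge0//; lra.
  rewrite /S big_distrr /=; apply: ler_sum_nat => j /andP[j1 _].
  have j1' : 1 <= j%:R :> R by rewrite ler1n.
  have pM := algorithm1_psd generated j.
  rewrite (extrap_diff alpha_ge3 j1 (algorithm1_xbar generated j1)).
  rewrite (extrap_diff alpha_ge3 j1 (algorithm1_lambar generated j1)).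
  rewrite !mnorm_sqr// !enorm_sqr -scalemxAr !dotZl !dotZr.
  rewrite -!mnorm_sqr// -!enorm_sqr.
  set X := mnorm _ _ ^+ 2; set Y := enorm _ ^+ 2.
  have XY0 : 0 <= X + Y by rewrite addr_ge0 ?sqr_ge0.
  (* The increments of the extrapolated sequences carry the factor j+alpha-2, which is at least
     j. *)
  rewrite [leRHS](_ : _ = (j%:R + alpha - 2) ^+ 2 * (X + Y)).
    by rewrite ler_wpM2r// ler_pXn2r// ?nnegrE; lra.
  by field; exact: lt0r_neq0.
(* Half the squared dual error is one of the nonnegative terms of an energy bounded by [E1]. *)
have muC j : (1 <= j)%N ->
    enorm (extrap alpha lam j - lamstar) <= Num.sqrt (2 * E1).
  move=> j1; rewrite -[leLHS]ger0_norm ?enorm_ge0// -sqrtr_sqr ler_wsqrtr//.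
  have := total _ j1; have := mulr_ge0 (weight0 _ j1) (gap0 j).
  have := sqr_ge0 (mnorm (M j.-1) (extrap alpha x j - xstar)).
  by have := S0 j; rewrite /energy; lra.
move=> k k1; have k1' : (1 <= k)%N := ltnW k1.
have kR : 1 < k%:R :> R by rewrite ltr1n.
have den0 : 0 < s * (k%:R - 1) * (k%:R + alpha - 3).
  by rewrite !mulr_gt0//; lra.
(* [residual_bound] gives this with 2 in place of 4. *)
have res : enorm (A *m x k - b) <= 4 * (alpha - 1) ^+ 2 * Num.sqrt (2 * E1)
    / (s * (k%:R - 1) * (k%:R + alpha - 3)).
  rewrite ler_pdivlMr//.
  have := residual_bound s_gt0 alpha_ge3 generated muC k1'.
  rewrite -(ler_pM2l s_gt0).
  have -> : s * (2 * ((alpha - 1) ^+ 2 / s * Num.sqrt (2 * E1)))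
      = 2 * ((alpha - 1) ^+ 2 * Num.sqrt (2 * E1)).
    by field; exact: lt0r_neq0.
  have := mulr_ge0 (sqr_ge0 (alpha - 1)) (sqrtr_ge0 (2 * E1)).
  by lra.
split=> //.
have gapE : lagrangian_gap F A b xstar lamstar (x k)
    <= (alpha - 1) ^+ 2 * E1 / (s * (k%:R ^+ 2 - k%:R)).
  have kk0 : 0 < s * (k%:R ^+ 2 - k%:R).
    by rewrite mulr_gt0// expr2 -{3}[k%:R]mulr1 -mulrBr mulr_gt0//; lra.
  rewrite ler_pdivlMr// mulrC -ler_pdivrMl ?exprn_gt0//.
  have := total _ k1'; have := S0 k.
  have := sqr_ge0 (mnorm (M k.-1) (extrap alpha x k - xstar)).
  have := sqr_ge0 (enorm (extrap alpha lam k - lamstar)).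
  rewrite /energy => h1 h2 h3 h4.
  rewrite [leLHS](_ : _ = s * k%:R * (k%:R - 1) / (alpha - 1) ^+ 2
    * lagrangian_gap F A b xstar lamstar (x k)); first lra.
  by field; exact: lt0r_neq0.
(* The gap is nonnegative, so bounding it above and the multiplier term by Cauchy-Schwarz controls
   both signs of the objective error. *)
have FE : F (x k) - F xstar = lagrangian_gap F A b xstar lamstar (x k)
    - dot lamstar (A *m x k - b) by rewrite /lagrangian_gap; ring.
rewrite FE; apply: le_trans (ler_normB _ _) _; apply: lerD.
  by rewrite ger0_norm.
apply: le_trans (norm_dot_le _ _) _.
by rewrite mulrC [leRHS]mulrAC ler_wpM2r ?enorm_ge0.
Unshelve. all: by end_near.
Qed.
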